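(* For every positive integer $m$ there is a finite set of points $S\subset\mathbb{R}^3$ such that for every coloring of $S$ with $3$ colors there is a unit ball in $\mathbb{R}^3$ that contains exactly $m$ points of $S$, all of the same color. *)

(* Defs.v *)
From mathcomp Require Import all_boot all_order all_algebra finmap.
From mathcomp Require Import reals.
Set Implicit Arguments.
Unset Strict Implicit.
Unset Printing Implicit Defensive.
Import Order.TTheory GRing.Theory Num.Theory.
Local Open Scope ring_scope.

(* The norm that MathComp-Analysis puts on 'rV[R]_n is the max norm, hence
   an explicit Euclidean norm. *)
Definition enorm (R : realType) (n : nat) (v : 'rV[R]_n) : R :=
  Num.sqrt (\sum_(i < n) v ord0 i ^+ 2).

(* Closed balls. For a finite point set, open balls give an equivalent
   statement (enlarge the radius slightly and rescale). *)
Definition unit_ball (R : realType) (n : nat) (o : 'rV[R]_n) :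
    pred 'rV[R]_n :=
  [pred x | enorm (x - o) <= 1].

(* Main.v *)
(** The points lie just inside the unit cylinder, in [m] thin vertical columns,
and three kinds of unit balls are used. A green ball is
centred on the axis and cuts every column near its own height only. A red or
blue ball belongs to one column, touches the cylinder there from one side or
the other, and misses the other columns.

Suppose that the columns, all at height [z], still need one green point each,
and that the [i]-th still needs [k_i] red or [l_i] blue points. Put a point [p]
into the first column and place three much smaller configurations next to it:
one at height [z - d], turned by [- t] in the first column, that needs one red
point less there; one at height [z + d], turned by [t], that needs one blue
point less; and one at height [z] without the first column. For [d ^ 2] of the
order of [t], the red balls of the first column in the first configuration
contain [p], and so do the blue ones in the second and the green ones in the
third, while there are no other incidences between the parts. Whatever the
colour of [p], the corresponding part therefore yields a monochromatic ball with
the right number of points. *)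
Require Import Defs.
From mathcomp Require Import all_boot all_order all_algebra finmap.
From mathcomp Require Import boolp classical_sets reals topology normedtype.
From mathcomp Require Import trigo ring lra zify.
Set Implicit Arguments.
Unset Strict Implicit.
Unset Printing Implicit Defensive.
Import Order.TTheory GRing.Theory Num.Theory numFieldNormedType.Exports.
Local Open Scope classical_set_scope.
Local Open Scope fset_scope.
Local Open Scope ring_scope.

(** * Perturbing and gluing configurations *)

Lemma near_all (T : Type) (I : eqType) (F : set_system T) (s : seq I)
    (P : I -> T -> Prop) : Filter F ->
  (forall i, i \in s -> \forall t \near F, P i t) ->
  \forall t \near F, forall i, i \in s -> P i t.
Proof.
move=> FF; elim: s => [_|i s IHs sP]; first exact: nearW.
have Pi := sP i (mem_head _ _).
have Ps : \forall t \near F, forall j, j \in s -> P j t.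
  by apply: IHs => j js; apply: sP; rewrite inE js orbT.
near=> t => j; rewrite inE => /predU1P[->|]; first by near: t.
by move: j; near: t.
Unshelve. all: by end_near. Qed.

Section Realizable.
Context {R : realType} {n : nat}.
Implicit Types x y o p : 'rV[R]_n.

Definition sqdist x y : R := \sum_(i < n) (x ord0 i - y ord0 i) ^+ 2.

Lemma unit_ballE o x : (x \in unit_ball o) = (sqdist x o <= 1).
Proof.
rewrite inE /enorm -[leRHS]sqrtr1 ler_sqrt//.
by under eq_bigr do rewrite !mxE.
Qed.

Definition eclose (e : R) x y := forall i, `|x ord0 i - y ord0 i| < e.

Lemma eclose_trans e1 e2 y x z :
  eclose e1 x y -> eclose e2 y z -> eclose (e1 + e2) x z.
Proof.
move=> xy yz i; apply: le_lt_trans (ler_distD (y ord0 i) _ _) _.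
by rewrite ltrD.
Qed.

Lemma eclose_le e1 e2 x y : e1 <= e2 -> eclose e1 x y -> eclose e2 x y.
Proof. by move=> e12 xy i; apply: lt_le_trans (xy i) e12. Qed.

Lemma eclose_refl (e : R) x : 0 < e -> eclose e x x.
Proof. by move=> e0 i; rewrite subrr normr0. Qed.

Lemma sqdist_near x o r : 0 < r -> \forall e \near 0^'+,
  forall x' o', eclose e x' x -> eclose e o' o ->
    `|sqdist x' o' - sqdist x o| < r.
Proof.
move=> r0; pose u i := x ord0 i - o ord0 i.
(* Each difference of squares is a factor of size at most [2 * e] times one which, for [e < 1], is
   at most twice |u i| + 1; the leading 1 makes [D] positive. *)
pose D := 1 + \sum_i 4 * (`|u i| + 1).
have D0 : 0 < D.
  by rewrite ltr_pwDl// sumr_ge0// => i _; rewrite mulr_ge0// addr_ge0.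
near=> e => x' o' xx' oo'.
have e0 : 0 < e by near: e; exact: nbhs_right_gt.
have e1 : e < 1 by near: e; exact: nbhs_right_lt.
have er : e < r / D by near: e; apply: nbhs_right_lt; rewrite divr_gt0.
rewrite ltr_pdivlMr// in er; apply: le_lt_trans er.
rewrite -sumrB; apply: le_trans (ler_norm_sum _ _ _) _.
rewrite /D mulrDr mulr1 mulr_sumr -[leLHS]add0r; apply: lerD (ltW e0) _.
apply: ler_sum => i _; rewrite subr_sqr normrM.
have h : `|x' ord0 i - o' ord0 i - u i| <= 2 * e.
  rewrite (_ : _ - _ = (x' ord0 i - x ord0 i) - (o' ord0 i - o ord0 i));
    last by rewrite /u; ring.
  apply: le_trans (ler_normB _ _) _.
  by have := xx' i; have := oo' i; lra.
rewrite -/(u i); set v := x' ord0 i - _ in h *.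
have hp : `|v + u i| <= 2 * (`|u i| + 1).
  rewrite (_ : v + u i = (v - u i) + (u i + u i)); last by ring.
  apply: le_trans (ler_normD _ _) _.
  by have := ler_normD (u i) (u i); lra.
apply: le_trans (ler_pM _ _ h hp) _ => //.
by rewrite le_eqVlt; apply/orP; left; apply/eqP; ring.
Unshelve. all: by end_near. Qed.

Lemma sqdist_gt_near x o : 1 < sqdist x o -> \forall e \near 0^'+,
  forall x' o', eclose e x' x -> eclose e o' o -> 1 < sqdist x' o'.
Proof.
rewrite -subr_gt0 => /(sqdist_near x o); apply: filterS => e xo x' o' xx' oo'.
by have := xo _ _ xx' oo'; rewrite ltr_norml; lra.
Qed.

Lemma sqdist_lt_near x o : sqdist x o < 1 -> \forall e \near 0^'+,
  forall x' o', eclose e x' x -> eclose e o' o -> sqdist x' o' < 1.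
Proof.
rewrite -subr_gt0 => /(sqdist_near x o); apply: filterS => e xo x' o' xx' oo'.
by have := xo _ _ xx' oo'; rewrite ltr_norml; lra.
Qed.

Lemma neq_near p x : p != x ->
  \forall e \near 0^'+, forall x', eclose e x' x -> p != x'.
Proof.
move=> px; have [i pxi] : exists i, p ord0 i != x ord0 i.
  apply/existsP; apply: contraNT px => /existsPn px.
  by apply/eqP/rowP => i; apply/eqP; have := px i; rewrite negbK.
near=> e => x' xx'; apply/eqP => pE.
have := xx' i; rewrite -pE ltNge => /negP; apply; apply: ltW.
by near: e; apply: nbhs_right_lt; rewrite normr_gt0 subr_eq0.
Unshelve. all: by end_near. Qed.

Context {I : finType}.
Implicit Types (X : seq 'rV[R]_n) (E : seq ('rV[R]_n * I * nat)).

(* An entry [(y, i, c)] of [E] announces a ball with centre near [y] that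
   contains [c] points of [S], all of colour [i].  That [S] and the centres may
   be taken arbitrarily close to [X] and [E] is what lets such a set be put next
   to others without disturbing them. *)
Definition realizable X E := forall e : R, 0 < e ->
  exists2 S : {fset 'rV[R]_n},
    (forall x, x \in S -> exists2 y, y \in X & eclose e x y) &
    forall f : 'rV[R]_n -> I, exists2 t, t \in E & exists2 o,
      eclose e o t.1.1 &
      #|` [fset x in S | sqdist x o <= 1]| = t.2 /\
      forall x, x \in S -> sqdist x o <= 1 -> f x = t.1.2.

(** The empty set meets a demand for no points; every branch of the later induction ends here. *)
Lemma realizable0 X E y i : (y, i, 0%N) \in E -> realizable X E.
Proof.
move=> yE e e0; exists fset0 => // f; exists (y, i, 0%N) => //.
exists y; first exact: eclose_refl.
split=> //; apply/eqP; rewrite cardfs_eq0; apply/eqP/fsetP => x.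
by rewrite !inE.
Qed.

(* If the new point [p] gets colour [A], the part [S_ A] provides a
   monochromatic ball, which is disjoint from the other parts and contains [p]
   only if it has colour [A]. *)
Lemma realizable_glue p (X_ : I -> seq 'rV[R]_n)
    (E_ : I -> seq ('rV[R]_n * I * nat)) :
  (forall A, realizable (X_ A) (E_ A)) ->
  (forall A B x t, A != B -> x \in X_ A -> t \in E_ B ->
    1 < sqdist x t.1.1) ->
  (forall A t, t \in E_ A ->
    (sqdist p t.1.1 < 1 /\ t.1.2 = A) \/ 1 < sqdist p t.1.1) ->
  (forall A, p \notin X_ A) ->
  forall e : R, 0 < e -> exists2 S : {fset 'rV[R]_n},
    (forall x, x \in S ->
      x = p \/ exists A, exists2 y, y \in X_ A & eclose e x y) &
    forall f : 'rV[R]_n -> I, exists A, exists2 t, t \in E_ A & exists2 o,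
      eclose e o t.1.1 &
      #|` [fset x in S | sqdist x o <= 1]| = (t.2 + (sqdist p t.1.1 < 1)%R)%N /\
      forall x, x \in S -> sqdist x o <= 1 -> f x = t.1.2.
Proof.
move=> XE farXE pE pX e e0.
(* The hypotheses are open conditions on finitely many points and centres, so one small perturbation
   bound [d] preserves them all. *)
have [d [/andP[d0 de] dXE inp outp dpX]] : exists d : R, [/\ 0 < d <= e,
    forall A B x t x' o', A != B -> x \in X_ A -> t \in E_ B ->
      eclose d x' x -> eclose d o' t.1.1 -> 1 < sqdist x' o',
    forall A t o', t \in E_ A -> sqdist p t.1.1 < 1 -> eclose d o' t.1.1 ->
      sqdist p o' < 1,
    forall A t o', t \in E_ A -> 1 < sqdist p t.1.1 -> eclose d o' t.1.1 ->
      1 < sqdist p o' &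
    forall A x x', x \in X_ A -> eclose d x' x -> p != x'].
  have n1 : \forall d \near 0^'+, forall A B, A != B ->
      forall x, x \in X_ A -> forall t, t \in E_ B ->
      forall x' o', eclose d x' x -> eclose d o' t.1.1 -> 1 < sqdist x' o'.
    apply: filter_forall => A; apply: filter_forall => B.
    have [_|AB] := eqVneq A B; first exact: nearW.
    suff: \forall d \near 0^'+, forall x, x \in X_ A ->
        forall t, t \in E_ B -> forall x' o',
        eclose d x' x -> eclose d o' t.1.1 -> 1 < sqdist x' o'.
      by apply: filterS => d + _.
    apply: near_all => x xX; apply: near_all => t tE.
    exact: sqdist_gt_near (farXE _ _ _ _ AB xX tE).
  have n2 : \forall d \near 0^'+, forall A t, t \in E_ A ->
      sqdist p t.1.1 < 1 -> forall x' o', eclose d x' p -> eclose d o' t.1.1 ->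
      sqdist x' o' < 1.
    apply: filter_forall => A; apply: near_all => t tE.
    have [lt1|_] := boolP (sqdist p t.1.1 < 1); last exact: nearW.
    by apply: filterS (sqdist_lt_near lt1) => d + _.
  have n3 : \forall d \near 0^'+, forall A t, t \in E_ A ->
      1 < sqdist p t.1.1 -> forall x' o', eclose d x' p -> eclose d o' t.1.1 ->
      1 < sqdist x' o'.
    apply: filter_forall => A; apply: near_all => t tE.
    have [gt1|_] := boolP (1 < sqdist p t.1.1); last exact: nearW.
    by apply: filterS (sqdist_gt_near gt1) => d + _.
  have n4 : \forall d \near 0^'+, forall A, forall x, x \in X_ A ->
      forall x', eclose d x' x -> p != x'.
    apply: filter_forall => A; apply: near_all => x xX.
    by apply: neq_near; apply: contraNneq (pX A) => ->.
  have [d [h1 [h2 [h3 [h4 [d0 de]]]]]] :=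
    @filter_ex _ _ (at_right_proper_filter 0) _
      (filterI n1 (filterI n2 (filterI n3 (filterI n4
        (filterI (nbhs_right_gt 0) (nbhs_right_le e0)))))).
  exists d; split; first by rewrite d0.
  - by move=> A B x t x' o' AB xX tE; exact: h1 AB _ xX _ tE _ _.
  - by move=> A t o' tE lt1; exact: h2 tE lt1 _ _ (eclose_refl p d0).
  - by move=> A t o' tE gt1; exact: h3 tE gt1 _ _ (eclose_refl p d0).
  - by move=> A x x' xX; exact: h4 xX _.
have /choice[S_ S_P] : forall A, exists S : {fset 'rV[R]_n},
    (forall x, x \in S -> exists2 y, y \in X_ A & eclose d x y) /\
    forall f : 'rV[R]_n -> I, exists2 t, t \in E_ A & exists2 o,
      eclose d o t.1.1 &
      #|` [fset x in S | sqdist x o <= 1]| = t.2 /\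
      forall x, x \in S -> sqdist x o <= 1 -> f x = t.1.2.
  by move=> A; have [S SX SC] := XE A d d0; exists S.
pose S := p |` \bigcup_(A <- enum I) S_ A.
have inS x : x \in S -> x = p \/ exists A, x \in S_ A.
  rewrite !inE => /predU1P[|/bigfcupP[A _ xA]]; first by left.
  by right; exists A.
have SS A x : x \in S_ A -> x \in S.
  move=> xA; rewrite !inE; apply/orP; right; apply/bigfcupP; exists A => //.
  by rewrite mem_enum.
have pS : p \in S by rewrite !inE eqxx.
move: S inS SS pS => S inS SS pS; exists S.
  move=> x /inS[|[A xA]]; [by left|right; exists A].
  by have [y yX xy] := (S_P A).1 x xA; exists y => //; exact: eclose_le xy.
move=> f; have [t tE [o ot [oS fo]]] := (S_P (f p)).2 f.
exists (f p), t => //; exists o; first exact: eclose_le ot.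
have inB x : x \in S -> sqdist x o <= 1 -> x = p \/ x \in S_ (f p).
  move=> /inS[|[A xA]]; first by left.
  have [<-|Ap] := eqVneq A (f p); first by right.
  have [z zX xz] := (S_P A).1 x xA.
  by rewrite leNgt (dXE _ _ _ _ _ _ Ap zX tE xz ot).
have pS_ : p \notin S_ (f p).
  apply/negP => /(S_P (f p)).1[z zX pz].
  by have := dpX _ _ _ zX pz; rewrite eqxx.
have [[lt1 tp]|gt1] := pE _ _ tE.
  have po : sqdist p o <= 1 by apply: ltW; exact: inp tE lt1 ot.
  split; last by move=> x xS xo; have [->//|xp] := inB x xS xo; exact: fo.
  have -> : [fset x in S | sqdist x o <= 1] =
      p |` [fset x in S_ (f p) | sqdist x o <= 1].
    apply/fsetP => x; rewrite !inE; apply/andP/predU1P.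
      by move=> [xS xo]; have [|xp] := inB x xS xo; [left|right; rewrite xp].
    by move=> [->//|/andP[xp xo]]; split => //; exact: SS xp.
  by rewrite cardfsU1 oS !inE (negPf pS_) lt1 addnC.
have po := outp _ _ _ tE gt1 ot.
have inB' x : x \in S -> sqdist x o <= 1 -> x \in S_ (f p).
  by move=> xS xo; have [xp|//] := inB x xS xo; move: xo; rewrite xp leNgt po.
split; last by move=> x xS xo; exact: fo (inB' x xS xo) xo.
rewrite ltNge (ltW gt1) addn0 -oS; congr #|` _|.
apply/fsetP => x; rewrite !inE; apply/andP/andP => -[xS xo].
  by rewrite (inB' x).
by split => //; exact: SS xS.
Qed.

(** The parts have to match [X] and [E] only up to [e / 2], since gluing costs another [e / 2]. A
    ball gains one point exactly when it contains [p], which completes the count wanted in [E]. *)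
Lemma realizable_step X E :
  (forall e : R, 0 < e -> exists p (X_ : I -> seq 'rV[R]_n)
    (E_ : I -> seq ('rV[R]_n * I * nat)), [/\
    forall A, realizable (X_ A) (E_ A),
    forall A B x t, A != B -> x \in X_ A -> t \in E_ B -> 1 < sqdist x t.1.1,
    forall A t, t \in E_ A ->
      ((sqdist p t.1.1 < 1 /\ t.1.2 = A) \/ 1 < sqdist p t.1.1) /\
      exists2 y, (y, t.1.2, (t.2 + (sqdist p t.1.1 < 1)%R)%N) \in E &
        eclose e t.1.1 y,
    forall A, p \notin X_ A &
    (exists2 y, y \in X & eclose e p y) /\
    forall A x, x \in X_ A -> exists2 y, y \in X & eclose e x y]) ->
  realizable X E.
Proof.
move=> H e e0; have e20 : 0 < e / 2 by rewrite divr_gt0.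
have [p [X_ [E_ [XE far pE pX [pe Xe]]]]] := H _ e20.
have [S SX SC] := realizable_glue XE far (fun A t tE => (pE A t tE).1) pX e20.
have e2e : e / 2 <= e by lra.
exists S => [x /SX[->|[A [y yX xy]]]|f].
- by have [y yX py] := pe; exists y => //; exact: eclose_le py.
- have [z zX yz] := Xe _ _ yX; exists z => //.
  by rewrite (splitr e); exact: eclose_trans xy yz.
have [A [t tE [o ot oS]]] := SC f; have [_ [y yE ty]] := pE _ _ tE.
exists (y, t.1.2, (t.2 + (sqdist p t.1.1 < 1)%R)%N) => //; exists o => //=.
by rewrite (splitr e); exact: eclose_trans ot ty.
Qed.

End Realizable.

(** * Unit balls in cylindrical coordinates *)

Lemma near_shift (R : realType) (f : R -> R) (a s e : R) :
  continuous f -> 0 < e ->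
  \forall t \near 0^'+, `|f (a + s * t) - f a| < e.
Proof.
move=> cf e0.
have : {for 0, continuous (f \o (fun t => a + s * t))}.
  apply: continuous_comp; last exact: cf.
  apply: cvgD; first exact: cvg_cst.
  by apply: cvgM; [exact: cvg_cst|exact: cvg_id].
move=> /cvg_at_right_filter/cvgr_distC_lt/(_ _ e0).
by rewrite /= mulr0 addr0.
Qed.

Section Columns.
Context {R : realType}.

Definition cyl (r a z : R) : 'rV[R]_3 :=
  \row_(i < 3) [:: r * cos a; r * sin a; z]`_i.

(** Law of cosines in the horizontal plane, Pythagoras in the vertical direction. *)
Lemma sqdist_cyl r a z r' a' z' : sqdist (cyl r a z) (cyl r' a' z') =
  r ^+ 2 + r' ^+ 2 - 2 * (r * r' * cos (a - a')) + (z - z') ^+ 2.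
Proof.
rewrite /sqdist !big_ord_recl big_ord0 !mxE /= cosB.
have /(canRL (addrK _)) := cos2Dsin2 a; have /(canRL (addrK _)) := cos2Dsin2 a'.
move=> c' c; rewrite addr0 addrA; congr (_ + _).
rewrite !sqrrB !exprMn c c'; ring.
Qed.

Lemma eclose_cyl (e r r' a a' z z' : R) :
  `|r * cos a - r' * cos a'| < e -> `|r * sin a - r' * sin a'| < e ->
  `|z - z'| < e -> eclose e (cyl r a z) (cyl r' a' z').
Proof.
by move=> h1 h2 h3 i; rewrite !mxE; case: i => -[|[|[|]]].
Qed.

Lemma eclose_cyl_near (e r a z s : R) : 0 < e -> \forall t \near 0^'+,
  forall z', `|z' - z| < e -> eclose e (cyl r (a + s * t) z') (cyl r a z).
Proof.
move=> e0.
have n1 := @near_shift _ (fun x => r * cos x) a s e _ e0.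
have n2 := @near_shift _ (fun x => r * sin x) a s e _ e0.
near=> t => z' zz'; apply: eclose_cyl => //.
  near: t; apply: n1 => x.
  by apply: cvgM; [exact: cvg_cst|exact: continuous_cos].
near: t; apply: n2 => x.
by apply: cvgM; [exact: cvg_cst|exact: continuous_sin].
Unshelve. all: by end_near. Qed.

Context (B : R).

(* On the unit cylinder, a point at angle [a] is outside the balls around the
   centres [red b z] and [blue b z] defined below. *)
Definition sep (a b : R) :=
  (cos (a - b - B) < cos B) && (cos (a - b + B) < cos B).

Lemma sep_sym a b : sep a b = sep b a.
Proof.
rewrite /sep andbC; congr (_ && _); rewrite -cosN; congr (cos _ < _); ring.
Qed.

Lemma sep_near a b s : sep a b -> \forall t \near 0^'+, sep (a + s * t) b.
Proof.
move=> /andP[]; rewrite -[in X in X -> _]subr_gt0 => h1.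
rewrite -[in X in X -> _]subr_gt0 => h2.
have n1 := @near_shift _ (@cos R) (a - b - B) s _ (@continuous_cos R) h1.
have n2 := @near_shift _ (@cos R) (a - b + B) s _ (@continuous_cos R) h2.
near=> t; apply/andP; split.
  have : `|cos (a - b - B + s * t) - cos (a - b - B)| < cos B - cos (a - b - B).
    by near: t; exact: n1.
  rewrite (_ : a + s * t - b - B = a - b - B + s * t); last by ring.
  by rewrite ltr_norml; lra.
have : `|cos (a - b + B + s * t) - cos (a - b + B)| < cos B - cos (a - b + B).
  by near: t; exact: n2.
rewrite (_ : a + s * t - b + B = a - b + B + s * t); last by ring.
by rewrite ltr_norml; lra.
Unshelve. all: by end_near. Qed.

(* The unit balls around [red a z] and [blue a z] have [cyl 1 a z] on their
   boundary, and cut the unit cylinder only between the angles [a] and [a + 2B],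
   respectively [a - 2B] and [a]. *)
Definition red a z := cyl (2 * cos B) (a + B) z.
Definition blue a z := cyl (2 * cos B) (a - B) z.

Lemma sqdist_red r a z b z' : sqdist (cyl r a z) (red b z') =
  r ^+ 2 + 4 * cos B * (cos B - r * cos (a - b - B)) + (z - z') ^+ 2.
Proof. by rewrite sqdist_cyl (_ : a - (b + B) = a - b - B); ring. Qed.

Lemma sqdist_blue r a z b z' : sqdist (cyl r a z) (blue b z') =
  r ^+ 2 + 4 * cos B * (cos B - r * cos (a - b + B)) + (z - z') ^+ 2.
Proof. by rewrite sqdist_cyl (_ : a - (b - B) = a - b + B); ring. Qed.

Lemma sqdist_axis r a z z' :
  sqdist (cyl r a z) (cyl 0 0 z') = r ^+ 2 + (z - z') ^+ 2.
Proof. by rewrite sqdist_cyl; ring. Qed.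

(* The angular and vertical shifts of the two children that keep all columns.
   The first inequality puts the new point into a red or blue ball of a child,
   the second one keeps the two children out of each other's balls; a suitable
   [d] exists because [cos (t + t - B) + cos B <= 2 * cos (t - B)]. *)
Lemma shift_exists (e a z : R) (L : seq R) : 0 < B -> B < pi / 2 -> 0 < e ->
  all (sep a) L ->
  exists t d : R, [/\ 0 < t, 0 < d,
    [/\ d ^+ 2 < 4 * cos B * (cos (t - B) - cos B),
      4 * cos B * (cos (t + t - B) - cos B) < (d + d) ^+ 2,
      cos (t + B) < cos B & cos (t + t + B) < cos B],
    forall s, s = 1 \/ s = -1 -> all (sep (a + s * t)) L &
    d < e /\ forall s, s = 1 \/ s = -1 ->
      [/\ eclose e (cyl 1 (a + s * t) (z + s * d)) (cyl 1 a z),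
        eclose e (red (a + s * t) (z + s * d)) (red a z) &
        eclose e (blue (a + s * t) (z + s * d)) (blue a z)]].
Proof.
move=> B_gt0 B_lt e0 /allP aL.
have cosB_gt0 : 0 < cos B.
  by apply: cos_gt0_pihalf; have := pi_gt0 R; lra.
have B_pi : B < pi by have := pi_gt0 R; lra.
pose g t := cos (t - B) - cos B.
(* The first inequality wants a factor below 4; the second wants one above 2, because
   [g (t + t) <= 2 * g t]. *)
pose d t := Num.sqrt (3 * cos B * g t).
have nd : \forall t \near 0^'+, d t < e.
  have h : 0 < e ^+ 2 / (3 * cos B) by rewrite divr_gt0 ?exprn_gt0 ?mulr_gt0.
  have n1 := @near_shift _ (@cos R) (- B) 1 _ (@continuous_cos R) h.
  near=> t; rewrite /d -(ger0_norm (ltW e0)) -sqrtr_sqr ltr_sqrt ?exprn_gt0//.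
  rewrite mulrC -ltr_pdivlMr ?mulr_gt0//.
  have : `|cos (- B + 1 * t) - cos (- B)| < e ^+ 2 / (3 * cos B).
    by near: t; exact: n1.
  rewrite /g (_ : - B + 1 * t = t - B); last by ring.
  by rewrite cosN; exact: le_lt_trans (ler_norm _).
have nL s : \forall t \near 0^'+, all (sep (a + s * t)) L.
  have : \forall t \near 0^'+, forall b, b \in L -> sep (a + s * t) b.
    by apply: near_all => b /aL; exact: sep_near.
  by apply: filterS => t /allP.
have nc s c r : \forall t \near 0^'+, forall z', `|z' - z| < e ->
    eclose e (cyl r (a + c + s * t) z') (cyl r (a + c) z).
  exact: eclose_cyl_near.
near (0 : R)^'+ => t.
have t0 : 0 < t by near: t; exact: nbhs_right_gt.
have tB : t < B by near: t; exact: nbhs_right_lt.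
(* This keeps [t + t + B] below [pi], where the cosine still decreases. *)
have tpi : t < (pi - B) / 2.
  by near: t; apply: nbhs_right_lt; rewrite divr_gt0// subr_gt0.
have g0 : 0 < g t.
  by rewrite subr_gt0 -[ltRHS]cosN ltr_cos// ?in_itv/=; lra.
have dE : d t ^+ 2 = 3 * cos B * g t.
  by rewrite sqr_sqrtr// !mulr_ge0// ltW.
have d0 : 0 < d t by rewrite sqrtr_gt0 !mulr_gt0.
have de : d t < e by near: t.
exists t, (d t); split => //.
- split.
  + by rewrite dE ltr_pM2r// ltr_pM2r//; lra.
  (* Sum to product: the left side is [2 * cos (t - B) * cos t]. *)
  + have ct : cos (t + t - B) + cos B <= 2 * cos (t - B).
      rewrite (_ : t + t - B = (t - B) + t); last by ring.
      rewrite (_ : cos B = cos ((t - B) - t)); last first.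
        by rewrite -cosN; congr cos; ring.
      rewrite (cosD (t - B) t) (cosB (t - B) t).
      have ct0 : 0 < cos (t - B).
        by apply: lt_trans cosB_gt0 _; rewrite -subr_gt0.
      by have := cos_le1 t; nra.
    rewrite (_ : (d t + d t) ^+ 2 = 4 * d t ^+ 2); last by ring.
    rewrite dE [ltRHS](_ : _ = 4 * cos B * (3 * g t)); last by ring.
    by rewrite ltr_pM2l ?mulr_gt0//; move: g0; rewrite /g; lra.
  + by rewrite ltr_cos// ?in_itv/=; lra.
  + by rewrite ltr_cos// ?in_itv/=; lra.
- by move=> s [] ->; near: t; exact: nL.
- split=> // s s1.
  have zd : `|z + s * d t - z| < e.
    rewrite addrC addKr normrM (gtr0_norm d0).
    by case: s1 => ->; rewrite ?normrN normr1 mul1r.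
  have cE c : a + s * t + c = a + c + s * t by ring.
  have h1 : eclose e (cyl 1 (a + 0 + s * t) (z + s * d t)) (cyl 1 (a + 0) z).
    by move: zd; case: s1 => ->; move: (z + _); near: t; exact: nc.
  have h2 : eclose e (cyl (2 * cos B) (a + B + s * t) (z + s * d t)) (red a z).
    by move: zd; case: s1 => ->; move: (z + _); near: t; exact: nc.
  have h3 : eclose e (cyl (2 * cos B) (a - B + s * t) (z + s * d t)) (blue a z).
    by move: zd; case: s1 => ->; move: (z + _); near: t; exact: nc.
  by rewrite addr0 in h1; rewrite /red /blue !cE.
Unshelve. all: by end_near. Qed.

(** On the cylinder, the new point would be on the boundary of the green ball at its height. A small
    move inwards puts it inside, preserves all strict incidences, and makes it differ from all
    [points]. *)
Lemma push_inside (I : finType) (E_ : I -> seq ('rV[R]_3 * I * nat))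
    (a z e : R) :
  0 < e -> exists r : R, [/\ 0 < r < 1, eclose e (cyl r a z) (cyl 1 a z) &
    forall A u, u \in E_ A ->
      (sqdist (cyl 1 a z) u.1.1 < 1 -> sqdist (cyl r a z) u.1.1 < 1) /\
      (1 < sqdist (cyl 1 a z) u.1.1 -> 1 < sqdist (cyl r a z) u.1.1)].
Proof.
move=> e0; set p := cyl 1 a z.
have n1 : \forall d \near 0^'+, forall A u, u \in E_ A ->
    sqdist p u.1.1 < 1 ->
    forall x' o', eclose d x' p -> eclose d o' u.1.1 -> sqdist x' o' < 1.
  apply: filter_forall => A; apply: near_all => u uE.
  have [lt1|_] := boolP (sqdist p u.1.1 < 1); last exact: nearW.
  by apply: filterS (sqdist_lt_near lt1) => d + _.
have n2 : \forall d \near 0^'+, forall A u, u \in E_ A ->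
    1 < sqdist p u.1.1 ->
    forall x' o', eclose d x' p -> eclose d o' u.1.1 -> 1 < sqdist x' o'.
  apply: filter_forall => A; apply: near_all => u uE.
  have [gt1|_] := boolP (1 < sqdist p u.1.1); last exact: nearW.
  by apply: filterS (sqdist_gt_near gt1) => d + _.
have [d [h1 [h2 [d0 [de d1]]]]] :=
  @filter_ex R _ (at_right_proper_filter 0) _ (filterI n1 (filterI n2
    (filterI (nbhs_right_gt 0) (filterI (nbhs_right_le e0)
      (nbhs_right_lt ltr01))))).
have {}d0 : 0 < d := d0; have {}d1 : d < 1 := d1.
have dp : eclose d (cyl (1 - d / 2) a z) p.
  have bnd (w : R) : `|w| <= 1 -> `|(1 - d / 2) * w - 1 * w| < d.
    move=> w1; rewrite -mulrBl normrM
      (_ : 1 - d / 2 - 1 = - (d / 2)); last ring.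
    have d2 : 0 < d / 2 by rewrite divr_gt0.
    rewrite normrN (gtr0_norm d2).
    have : d / 2 * `|w| <= d / 2 * 1 by rewrite ler_pM2l.
    by lra.
  by apply: eclose_cyl; rewrite ?bnd ?cos_max ?sin_max ?subrr ?normr0.
exists (1 - d / 2); split; first by lra.
  exact: eclose_le dp.
move=> A u uE; split => [lt1|gt1].
  by apply: h1 uE lt1 _ _ dp _; exact: eclose_refl.
by apply: h2 uE gt1 _ _ dp _; exact: eclose_refl.
Qed.

(** * Induction on the columns *)

Definition cred : 'I_3 := @Ordinal 3 0 isT.
Definition cblue : 'I_3 := @Ordinal 3 1 isT.
Definition cgreen : 'I_3 := @Ordinal 3 2 isT.

Lemma ord3_ind (P : 'I_3 -> Prop) :
  P cred -> P cblue -> P cgreen -> forall A, P A.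
Proof.
move=> P0 P1 P2 [[|[|[|//]]] iA].
- by rewrite (_ : Ordinal iA = cred)//; apply: val_inj.
- by rewrite (_ : Ordinal iA = cblue)//; apply: val_inj.
- by rewrite (_ : Ordinal iA = cgreen)//; apply: val_inj.
Qed.

(** These are limit positions, one per column; the actual points cluster near them. *)
Definition points (s : seq (R * nat * nat)) z := [seq cyl 1 u.1.1 z | u <- s].

(* The entry [(a, k, l)] of [s] stands for a column at angle [a] from which [k]
   red or [l] blue points are still wanted; the green ball around [cyl 0 0 z]
   wants one point from each column. *)
Definition balls (s : seq (R * nat * nat)) z : seq ('rV[R]_3 * 'I_3 * nat) :=
  (cyl 0 0 z, cgreen, size s) ::
  [seq (red u.1.1 z, cred, u.1.2) | u <- s] ++
  [seq (blue u.1.1 z, cblue, u.2) | u <- s].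

Lemma ballsP s z u : u \in balls s z -> [\/ u = (cyl 0 0 z, cgreen, size s),
  exists2 v, v \in s & u = (red v.1.1 z, cred, v.1.2) |
  exists2 v, v \in s & u = (blue v.1.1 z, cblue, v.2)].
Proof.
rewrite inE mem_cat => /predU1P[|/orP[]/mapP[v vs ->]]; first by constructor 1.
  by constructor 2; exists v.
by constructor 3; exists v.
Qed.

Lemma red_balls s z v : v \in s -> (red v.1.1 z, cred, v.1.2) \in balls s z.
Proof.
move=> vs; rewrite inE mem_cat; apply/orP; right; apply/orP; left.
by apply/mapP; exists v.
Qed.

Lemma blue_balls s z v : v \in s -> (blue v.1.1 z, cblue, v.2) \in balls s z.
Proof.
move=> vs; rewrite inE mem_cat; apply/orP; right; apply/orP; right.
by apply/mapP; exists v.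
Qed.

Lemma pairwise_sep (s : seq R) a b :
  pairwise sep s -> a \in s -> b \in s -> a = b \/ sep a b.
Proof.
elim: s => // c s IHs; rewrite pairwise_cons => /andP[/allP cs ss].
rewrite !inE => /predU1P[->|aS] /predU1P[->|bS].
- by left.
- by right; exact: cs.
- by right; rewrite sep_sym; exact: cs.
- exact: IHs.
Qed.

(** The analogue of [sep] for a point and balls at different heights, [D] being the squared
    difference. *)
Definition apart a b D :=
  4 * cos B * (cos (a - b - B) - cos B) < D /\
  4 * cos B * (cos (a - b + B) - cos B) < D.

Lemma sep_apart a b D : 0 < cos B -> sep a b -> 0 <= D -> apart a b D.
Proof.
move=> cB /andP[h1 h2] D0; split; apply: lt_le_trans D0;
  by rewrite pmulr_rlt0 ?mulr_gt0// subr_lt0.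
Qed.

(** The balls of a column have its point on their boundary, so any difference in height puts it
    outside. *)
Lemma eq_apart a D : 0 < D -> apart a a D.
Proof. by move=> D0; split; rewrite subrr add0r ?cosN subrr mulr0. Qed.

(** Induction on the total demand: the green part drops the first column, the two others lower one
    of its demands. The successor in the sum forces [s] to be empty when [N = 0]. *)
Lemma realizable_columns : 0 < B -> B < pi / 2 -> forall N s z,
  (\sum_(u <- s) (u.1.2 + u.2).+1 <= N)%N ->
  pairwise sep [seq u.1.1 | u <- s] ->
  realizable (points s z) (balls s z).
Proof.
move=> B_gt0 B_lt.
have cB : 0 < cos B by apply: cos_gt0_pihalf; have := pi_gt0 R; lra.
elim=> [|N IHN] [|[[a k1] k2] L] z.
- move=> _ _; apply: (@realizable0 _ _ _ _ _ (cyl 0 0 z) cgreen).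
  by rewrite inE eqxx.
- by rewrite big_cons.
- move=> _ _; apply: (@realizable0 _ _ _ _ _ (cyl 0 0 z) cgreen).
  by rewrite inE eqxx.
case: k1 => [_ _|k1].
  apply: (@realizable0 _ _ _ _ _ (red a z) cred).
  exact: red_balls (mem_head _ _).
case: k2 => [_ _|k2].
  apply: (@realizable0 _ _ _ _ _ (blue a z) cblue).
  exact: blue_balls (mem_head _ _).
rewrite big_cons /= => sN /andP[aL LL].
apply: realizable_step => e e0.
have [t [d [t0 d0 [ineq1 ineq2 ineq3 ineq4] tL [de tclose]]]] :=
  shift_exists z B_gt0 B_lt e0 aL.
(* Red has index 0 and blue 1. Green, of index 2, gets the default values: the list [L] and, in
   [h_], the offset 0. *)
pose s_ (A : 'I_3) := nth L [:: (a + -1 * t, k1, k2.+1) :: L;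
  (a + 1 * t, k1.+1, k2) :: L] A.
pose h_ (A : 'I_3) := z + [:: -1; 1]`_A * d.
have [r [/andP[r0 r1] rclose rP]] :=
  push_inside (fun A => balls (s_ A) (h_ A)) a z e0.
set p := cyl r a z in rclose rP.
exists p, (fun A => points (s_ A) (h_ A)), (fun A => balls (s_ A) (h_ A)).
have hclose A : `|h_ A - z| < e.
  rewrite addrC addKr normrM (gtr0_norm d0).
  by elim/ord3_ind: A; rewrite /= ?normrN ?normr1 ?mul1r// normr0 mul0r.
have sL A v : v \in s_ A -> v \in L \/
    (A = cred /\ v = (a + -1 * t, k1, k2.+1)) \/
    (A = cblue /\ v = (a + 1 * t, k1.+1, k2)).
  by elim/ord3_ind: A; rewrite /s_/= ?inE; [case/predU1P|case/predU1P|]; auto.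
have aL' v : v \in L -> sep a v.1.1.
  by move=> vL; apply: (allP aL); exact: map_f.
have hD A A' : A != A' -> 0 < (h_ A - h_ A') ^+ 2.
  have dd : 0 < d * d by rewrite mulr_gt0.
  by move: A A'; do 2![apply: ord3_ind] => //= _; rewrite /h_/=; nra.
have head_apart s v D : s = 1 \/ s = -1 -> v \in L -> 0 <= D ->
    apart (a + s * t) v.1.1 D /\ apart v.1.1 (a + s * t) D.
  move=> s1 vL D0; have sv : sep (a + s * t) v.1.1.
    by apply: (allP (tL s s1)); exact: map_f.
  by split; apply: sep_apart => //; rewrite sep_sym.
(* A column of [L] present in both parts is separated by height alone. The two copies of the first
   column are turned by [t + t] against each other, which [ineq2] and [ineq4] handle. *)
have far A A' v v' : A != A' -> v \in s_ A -> v' \in s_ A' ->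
    apart v.1.1 v'.1.1 ((h_ A - h_ A') ^+ 2).
  move=> AA' vA v'A; have D0 := hD _ _ AA'.
  have [vL|[[EA ->]|[EA ->]]] := sL _ _ vA;
  have [v'L|[[EA' ->]|[EA' ->]]] := sL _ _ v'A.
  - have [->|] := pairwise_sep LL (map_f _ vL) (map_f _ v'L).
      exact: eq_apart.
    by move=> vv'; apply: sep_apart => //; exact: ltW.
  - by apply: (head_apart (-1) v _ _ vL (ltW D0)).2; right.
  - by apply: (head_apart 1 v _ _ vL (ltW D0)).2; left.
  - by apply: (head_apart (-1) v' _ _ v'L (ltW D0)).1; right.
  - by rewrite EA EA' eqxx in AA'.
  - rewrite EA EA' /h_/=.
    have -> : (z + -1 * d - (z + 1 * d)) ^+ 2 = (d + d) ^+ 2 by ring.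
    split.
      rewrite (_ : cos (_ - _ - B) = cos (t + t + B)); last first.
        by rewrite -cosN; congr cos; ring.
      apply: lt_trans (_ : 0 < _); last by rewrite exprn_gt0 ?addr_gt0.
      by rewrite pmulr_rlt0 ?mulr_gt0// subr_lt0.
    rewrite (_ : cos (_ - _ + B) = cos (t + t - B))//.
    by rewrite -cosN; congr cos; ring.
  - by apply: (head_apart 1 v' _ _ v'L (ltW D0)).1; left.
  - rewrite EA EA' /h_/=.
    have -> : (z + 1 * d - (z + -1 * d)) ^+ 2 = (d + d) ^+ 2 by ring.
    split; first by rewrite (_ : _ - _ - B = t + t - B)//=; ring.
    rewrite (_ : _ - _ + B = t + t + B)/=; last by ring.
    apply: lt_trans (_ : 0 < _); last by rewrite exprn_gt0 ?addr_gt0.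
    by rewrite pmulr_rlt0 ?mulr_gt0// subr_lt0.
  - by rewrite EA EA' eqxx in AA'.
split.
- move=> A; apply: IHN.
    move: sN; elim/ord3_ind: A; rewrite /s_/= ?big_cons/=;
    by move: (\sum_(_ <- L) _)%N; clear; lia.
  by elim/ord3_ind: A; rewrite /s_/= ?LL ?andbT//; apply: tL; auto.
- move=> A A' x u AA' /mapP[v vA ->] /ballsP[->|[v' v'A ->]|[v' v'A ->]] /=.
  + by rewrite sqdist_axis expr1n ltrDl hD.
  + by have [+ _] := far _ _ _ _ AA' vA v'A; rewrite sqdist_red; lra.
  + by have [_ +] := far _ _ _ _ AA' vA v'A; rewrite sqdist_blue; lra.
(* [b] tells whether [p] lies in the ball, and hence whether it adds one to the count. *)
- suff inout A u : u \in balls (s_ A) (h_ A) -> exists b : bool,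
      (if b then sqdist p u.1.1 < 1 /\ u.1.2 = A else 1 < sqdist p u.1.1) /\
      exists2 y, (y, u.1.2, (u.2 + b)%N) \in balls ((a, k1.+1, k2.+1) :: L) z &
        eclose e u.1.1 y.
    move=> A u /inout[b [ub yb]].
    have -> : (sqdist p u.1.1 < 1) = b.
      by case: b ub {yb} => [[]//|ub]; apply/negbTE; rewrite -leNgt ltW.
    by split=> //; case: b ub {yb} => [[_ ub]|ub]; [left|right].
  have zclose w c : eclose e (cyl w c (h_ A)) (cyl w c z).
    by apply: eclose_cyl; rewrite ?subrr ?normr0.
  have cosB4 : 0 < 4 * cos B by rewrite mulr_gt0.
  have zh : 0 <= (z - h_ A) ^+ 2 by exact: sqr_ge0.
  move=> uA; have [inP outP] := rP A u uA; move: uA inP outP.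
  move=> /ballsP[->|[v vA ->]|[v vA ->]] /= inP outP.
  (* The green ball at height [z] contains [p] because [r < 1]; those at heights [z - d] and [z + d]
     miss even the cylinder point, hence [p]. *)
  - have [A2|A2] := eqVneq A cgreen.
      exists true; rewrite A2 /s_ addn1; split; last first.
        exists (cyl 0 0 z); first by rewrite inE eqxx.
        by rewrite -A2.
      split=> //; rewrite sqdist_axis /h_/= mul0r addr0 subrr expr0n addr0.
      by rewrite expr_lt1// ltW.
    exists false; split; last first.
      exists (cyl 0 0 z) => //; rewrite addn0 (_ : size _ = (size L).+1).
        by rewrite inE eqxx.
      by elim/ord3_ind: A A2 {inP outP zclose zh}.
    apply: outP; rewrite sqdist_axis expr1n ltrDl.
    rewrite (_ : z = h_ cgreen); last by rewrite /h_/= mul0r addr0.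
    by rewrite hD// eq_sym.
  - have [vL|[[EA Ev]|[EA Ev]]] := sL _ _ vA.
    + exists false; split.
        apply: outP; rewrite sqdist_red.
        by have /andP[] := aL' _ vL; nra.
      exists (red v.1.1 z); last exact: zclose.
      by rewrite addn0; apply: red_balls; rewrite inE vL orbT.
    + exists true; rewrite EA Ev /=; split; last first.
        exists (red a z); last by have [] := tclose (-1) (or_intror erefl).
        by rewrite addn1; exact: red_balls (mem_head _ _).
      (* By [ineq1], the red ball turned by [- t] reaches far enough past angle [a] to contain [p]
         despite the vertical distance [d]. *)
      split=> //; move: inP; rewrite EA Ev /=; apply; rewrite sqdist_red /h_/=.
      rewrite (_ : a - _ - B = t - B); last by ring.
      by move: ineq1; nra.
    + exists false; rewrite EA Ev /=; split; last first.
        exists (red a z); last by have [] := tclose 1 (or_introl erefl).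
        by rewrite addn0; exact: red_balls (mem_head _ _).
      (* In the blue part the red ball starts only at angle [a + t], beyond [p]. The blue balls
         below are the mirror image. *)
      move: outP; rewrite EA Ev /=; apply; rewrite sqdist_red /h_/=.
      rewrite (_ : cos (a - _ - B) = cos (t + B)); last first.
        by rewrite -cosN; congr cos; ring.
      by have := sqr_ge0 d; nra.
  - have [vL|[[EA Ev]|[EA Ev]]] := sL _ _ vA.
    + exists false; split.
        apply: outP; rewrite sqdist_blue.
        by have /andP[] := aL' _ vL; nra.
      exists (blue v.1.1 z); last exact: zclose.
      by rewrite addn0; apply: blue_balls; rewrite inE vL orbT.
    + exists false; rewrite EA Ev /=; split; last first.
        exists (blue a z); last by have [] := tclose (-1) (or_intror erefl).
        by rewrite addn0; exact: blue_balls (mem_head _ _).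
      move: outP; rewrite EA Ev /=; apply; rewrite sqdist_blue /h_/=.
      rewrite (_ : a - _ + B = t + B); last by ring.
      by have := sqr_ge0 d; nra.
    + exists true; rewrite EA Ev /=; split; last first.
        exists (blue a z); last by have [] := tclose 1 (or_introl erefl).
        by rewrite addn1; exact: blue_balls (mem_head _ _).
      split=> //; move: inP; rewrite EA Ev /=; apply; rewrite sqdist_blue /h_/=.
      rewrite (_ : cos (a - _ + B) = cos (t - B)); last first.
        by rewrite -cosN; congr cos; ring.
      by move: ineq1; nra.
(* [p] is at distance [r < 1] from the axis, the points of the parts at distance 1. *)
- move=> A; apply/negP => /mapP[v _ pE].
  have := sqdist_axis r a z z; rewrite -/p pE sqdist_axis subrr.
  have := sqr_ge0 (h_ A - z); nra.
split; first by exists (cyl 1 a z); rewrite ?mem_head.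
move=> A x /mapP[v vA ->]; have [vL|[[EA ->]|[EA ->]]] := sL _ _ vA.
- exists (cyl 1 v.1.1 z); first by rewrite inE; apply/orP; right; exact: map_f.
  by apply: eclose_cyl; rewrite ?subrr ?normr0.
- exists (cyl 1 a z); rewrite ?mem_head// EA.
  by have [] := tclose (-1) (or_intror erefl).
- exists (cyl 1 a z); rewrite ?mem_head// EA.
  by have [] := tclose 1 (or_introl erefl).
Qed.

End Columns.

(** * Placing the columns *)

(** Two angles differ by at least [3 * B]; after a shift by [B] either way the difference stays
    between [2 * B] and [pi], where the cosine is below [cos B]. *)
Lemma equispaced_sep (R : realType) (m : nat) (B : R) : 0 < B ->
  3 * m%:R * B <= pi -> pairwise (sep B) (mkseq (fun i => 3 * B * i%:R) m).
Proof.
move=> B0 mB; apply/(pairwiseP 0) => i j; rewrite !inE size_mkseq => im jm ij.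
rewrite !nth_mkseq//; have [k jE] : exists k, j = (i + k.+1)%N.
  by exists (j - i.+1)%N; rewrite addnS -addSn subnKC.
have Bk : 0 <= B * k%:R by rewrite mulr_ge0// ltW.
have kB : 3 * (B * k%:R) + 6 * B <= pi.
  apply: le_trans mB; rewrite -mulrA [X in _ <= 3 * X]mulrC.
  have : B * (k.+2)%:R <= B * m%:R.
    by rewrite ler_pM2l// ler_nat (leq_trans _ jm)// jE ltnS leq_addl.
  by rewrite -[k.+2]addn2 natrD; lra.
rewrite /sep jE -[k.+1]addn1 !natrD.
rewrite (_ : _ - _ - B = - (3 * (B * k%:R) + 4 * B)); last by ring.
rewrite (_ : _ - _ + B = - (3 * (B * k%:R) + 2 * B)); last by ring.
by rewrite !cosN !ltr_cos ?in_itv/=; lra.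
Qed.

Local Close Scope classical_set_scope.
Local Close Scope fset_scope.

Theorem theorem15 (R : realType) (m : nat) (hm : (0 < m)%N) :
  exists S : {fset 'rV[R]_3},
    forall c : S -> 'I_3,
      exists o : 'rV[R]_3,
        #|[set p : S | fsval p \in unit_ball o]| = m /\
        (forall p q : S, fsval p \in unit_ball o -> fsval q \in unit_ball o ->
           c p = c q).
Proof.
(* This gives [3 * m%:R * B <= pi] for the spacing, and the added 3 gives [B <= pi / 3]. *)
pose B : R := pi / (3 * m%:R + 3).
have m0 : 0 < 3 * m%:R + 3 :> R by rewrite ltr_wpDl ?mulr_ge0.
have pi0 := pi_gt0 R.
have BE : B * (3 * m%:R + 3) = pi by rewrite divfK// gt_eqF.
have B0 : 0 < B by rewrite divr_gt0.
have Bm : 0 <= B * m%:R by rewrite mulr_ge0// ltW.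
have B_lt : B < pi / 2 by lra.
(* With [m] columns, each wanting [m] red or [m] blue points, every ball wants [m] points. *)
pose s := mkseq (fun i => (3 * B * i%:R, m, m)) m.
have sep_s : pairwise (sep B) [seq u.1.1 | u <- s].
  by rewrite /s /mkseq -map_comp; apply: equispaced_sep => //; lra.
have [S _ SP] := realizable_columns B0 B_lt 0 (leqnn _) sep_s ltr01.
(* Only the values of [f] on [S] matter; [ord0] is a dummy colour elsewhere. *)
exists S => c; pose f x := if insub x is Some y then c y else ord0.
have [t tE [o _ [oS fo]]] := SP f; exists o; split.
  have t2 : t.2 = m.
    move/ballsP: tE => [->|[v vs ->]|[v vs ->]] /=; first by rewrite size_mkseq.
      by case/mapP: vs => i _ ->.
    by case/mapP: vs => i _ ->.
  rewrite -t2 -oS -(@card_fsub _ S); last first.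
    by apply/fsubsetP => x; rewrite !inE => /andP[].
  apply: eq_card => x; rewrite !inE.
  by rewrite -unit_ballE fsvalP.
have cE (p : S) : fsval p \in unit_ball o -> c p = t.1.2.
  rewrite unit_ballE => po; rewrite -(fo _ (fsvalP p) po) /f.
  by rewrite (valK p).
by move=> p q po qo; rewrite (cE p po) (cE q qo).
Qed.
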